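(* For each $n$ let $X_{1,n},\dots,X_{n,n}$ be i.i.d. taking values in $\{-1.5,0.5\}$ with $\mathbb P(X_{i,n}=-1.5)=\mathbb P(X_{i,n}=0.5)=0.5$, so that $\mu_n=\mathbb E[X_{1,n}]=-0.5$, and let $\bar X_n=\frac1n\sum_{i=1}^nX_{i,n}$. Define $$P(\bar X_n)=\frac{1-\Phi\left(n^{1/2}(\bar X_n-\mu_n)\right)}{1-\Phi\left(2-n^{1/2}\mu_n\right)}.$$ Then the conditional distribution of $P(\bar X_n)$ given $n^{1/2}\bar X_n>2$ does not converge weakly to $\mathrm{Unif}(0,1)$ as $n\to\infty$.
   Context: $\Phi$ is the CDF of the standard normal distribution $N(0,1)$. The event $\{n^{1/2}\bar X_n>2\}$ is the event that the sample mean ''survives the file drawer effect''. *)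

(* Defs.v *)
From HB Require Import structures.
From mathcomp Require Import all_boot all_order all_algebra.
From mathcomp Require Import all_classical all_reals all_analysis.
From mathcomp Require Import measurable_realfun.

Set Implicit Arguments.
Unset Strict Implicit.
Unset Printing Implicit Defensive.

Import Order.TTheory GRing.Theory Num.Theory.
Import numFieldNormedType.Exports.

Local Open Scope classical_set_scope.
Local Open Scope ring_scope.

Section iid.
Context d (T : measurableType d) (R : realType) (P : probability T R).
Context (I : finType).

Definition mutually_independent (X : I -> {RV P >-> R}) : Prop :=
  forall (J : {set I}) (B : I -> set R), (forall i, measurable (B i)) ->
    P (\bigcap_(i in [set` J]) (X i @^-1` B i)) =
    (\prod_(i in J) P (X i @^-1` B i))%E.

Definition identically_distributed (X : I -> {RV P >-> R}) : Prop :=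
  forall (i j : I) (B : set R), measurable B ->
    distribution P (X i) B = distribution P (X j) B.

Definition iid (X : I -> {RV P >-> R}) : Prop :=
  mutually_independent X /\ identically_distributed X.

End iid.

(* Weak convergence of Borel probability measures on the real line, with bounded
   continuous test functions. [R] and [measurableTypeR R] are the same set with
   the same Borel sets under two displays; the limit lives on the latter because
   the named distributions of the library do. *)
Definition weak_cvg (R : realType) (Q : nat -> probability R R)
    (Q' : probability (measurableTypeR R) R) : Prop :=
  forall f : R -> R, continuous f -> (exists M : R, forall x, `|f x| <= M) ->
    (\int[Q n]_x (f x)%:E)%E @[n --> \oo] --> (\int[Q']_x (f x)%:E)%E.

Section conditioning.
Context d (T : measurableType d) (R : realType) (P : probability T R).

(* P(. | A). When P A = 0 the conditional probability is undefined; as a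
   totalisation [mnormalize] then returns its second argument, here P itself. *)
Definition cond_prob (A : set T) (mA : measurable A) : probability T R :=
  mnormalize (mrestr P mA) P.

Lemma cond_probE (A : set T) (mA : measurable A) (B : set T) :
  P A != 0%E -> cond_prob mA B = (P (B `&` A) * (fine (P A))^-1%:E)%E.
Proof.
move=> PA0; rewrite /cond_prob /= /mnormalize /= /mrestr setTI (negbTE PA0) /=.
by rewrite lt_eqF // (le_lt_trans (probability_le1 P mA)) // ltry.
Qed.

Definition cond_distribution (A : set T) (mA : measurable A)
    (Y : {mfun T >-> R}) : probability R R :=
  distribution (cond_prob mA) Y.

End conditioning.

Section sample_mean.
Context d (T : measurableType d) (R : realType).
Context (n : nat) (X : 'I_n -> {mfun T >-> R}).

Definition sample_mean (t : T) : R := n%:R^-1 * \sum_(i < n) X i t.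

Lemma measurable_sample_mean : measurable_fun [set: T] sample_mean.
Proof.
apply: measurable_funM; first exact: measurable_cst.
by apply: measurable_sum => i; exact: measurable_funP.
Qed.

HB.instance Definition _ :=
  isMeasurableFun.Build _ _ _ _ sample_mean measurable_sample_mean.

(* The event that the sample mean survives the file drawer effect. *)
Definition survival : set T := [set t | 2 < Num.sqrt n%:R * sample_mean t].

Lemma measurable_survival : measurable survival.
Proof.
rewrite (_ : survival =
  (fun t => Num.sqrt n%:R * sample_mean t) @^-1` `]2, +oo[); last first.
  by apply/seteqP; split => t; rewrite /survival /= in_itv /= andbT.
have mf : measurable_fun [set: T] (fun t => Num.sqrt n%:R * sample_mean t).
  apply: measurable_funM; first exact: measurable_cst.
  exact: measurable_sample_mean.
by rewrite -[X in measurable X]setTI; apply: mf.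
Qed.

End sample_mean.

Section pvalue.
Context (R : realType).

Definition Phi (x : R) : R := fine (normal_prob (0 : R) 1 `]-oo, x]).

Lemma Phi_nondecreasing : {homo Phi : x y / x <= y}.
Proof.
move=> x y xy; rewrite /Phi fine_le ?fin_num_measure//.
by rewrite le_measure ?inE//; exact: subitvPr.
Qed.

Definition pvalue (n : nat) (mu x : R) : R :=
  (1 - Phi (Num.sqrt n%:R * (x - mu))) / (1 - Phi (2 - Num.sqrt n%:R * mu)).

Lemma measurable_pvalue (n : nat) (mu : R) :
  measurable_fun [set: R] (pvalue n mu).
Proof.
apply: measurable_funM; last exact: measurable_cst.
apply: measurable_funB; first exact: measurable_cst.
have mPhi : measurable_fun [set: R] Phi.
  by apply: nondecreasing_measurable => // x y; exact: Phi_nondecreasing.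
apply: (measurableT_comp mPhi).
apply: measurable_funM; first exact: measurable_cst.
by apply: measurable_funB; [exact: measurable_id|exact: measurable_cst].
Qed.

HB.instance Definition _ (n : nat) (mu : R) :=
  isMeasurableFun.Build _ _ _ _ (pvalue n mu) (measurable_pvalue n mu).

End pvalue.

(* Main.v *)
Require Import Defs.
From mathcomp Require Import all_boot all_order all_algebra.
From mathcomp Require Import all_classical all_reals all_analysis.
From mathcomp Require Import measurable_realfun lra zify.

Import Order.TTheory GRing.Theory Num.Theory.
Import numFieldNormedType.Exports.

Local Open Scope classical_set_scope.
Local Open Scope ring_scope.

(** Survival asks for a sample mean far above its expectation, and there the
    binomial weights decay geometrically. Let [S] be the number of draws equal
    to 1/2. Then [n^(1/2) * mean > 2] means [S >= k] for a threshold
    [k = k_n >= 3n/4], and for such [k]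
      ['C(n, k+1) / 'C(n, k) = (n - k) / (k + 1) <= 1/3],
    so the whole tail ['C(n, k) + 'C(n, k+1) + ...] is at most
    [3/2 * 'C(n, k)]. Given survival, the event [S = k] thus has probability at
    least 2/3, and the p-value, being a function of [S], takes one single value
    with that probability ([pvalue_has_large_atom]).

    A sequence of laws each having an atom of mass at least [c > 1/2] cannot
    converge weakly to the uniform law, wherever the atoms lie
    ([large_atoms_not_weak_cvg_uniform]): every atom is in one of the two
    half-lines cut at 1/2, while the uniform law gives each half-line mass only
    1/2. *)

(** * Large atoms exclude a uniform weak limit *)

Lemma le_integral_of_ge1 {R : realType} {d} {T : measurableType d}
    (Q : {measure set T -> \bar R}) (A : set T) (f : T -> R) :
  measurable A -> measurable_fun setT f -> (forall x, 0 <= f x) ->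
  (forall x, A x -> 1 <= f x) -> (Q A <= \int[Q]_x (f x)%:E)%E.
Proof.
move=> mA mf f0 f1; rewrite -[A]setIT -integral_indic//.
apply: ge0_le_integral => //.
- exact/measurable_EFinP.
- exact/measurable_EFinP.
move=> x _; rewrite lee_fin indicE.
by have [/set_mem/f1|] := boolP (x \in A).
Qed.

Lemma integral_uniform01_le {R : realType} (f : R -> R) (a b : R) :
  measurable_fun setT f -> (forall x, 0 <= f x <= 1) ->
  (forall x, 0 <= x <= 1 -> f x != 0 -> a <= x <= b) -> a <= b ->
  (\int[uniform_prob (@ltr01 R)]_x (f x)%:E <= (b - a)%:E)%E.
Proof.
move=> mf f01 fab ab; rewrite integral_uniform//; last 2 first.
- exact/measurable_EFinP.
- by move=> x; rewrite lee_fin; case/andP: (f01 x).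
rewrite subr0 invr1 mul1e.
apply: (@le_trans _ _
  (\int[lebesgue_measure]_(x in `[0%R, 1%R]) (\1_`[a, b]%classic x)%:E)%E).
  apply: ge0_le_integral => //.
  - by move=> x _; rewrite lee_fin; case/andP: (f01 x).
  - by apply/measurable_EFinP; exact: measurable_funTS.
  - by apply/measurable_EFinP; exact: measurable_funTS.
  move=> x /=; rewrite in_itv/= => x01; rewrite lee_fin indicE mem_setE in_itv/=.
  have [->|/(fab _ x01) ->] := eqVneq (f x) 0; first by rewrite ler0n.
  by case/andP: (f01 x).
rewrite integral_indic//.
apply: (@le_trans _ _ (lebesgue_measure (`[a, b]%classic : set R))).
  by apply: le_measure; rewrite ?inE//; exact: measurableI.
rewrite lebesgue_measure_itv/= lte_fin; case: ifP => _; first by rewrite EFinB.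
by rewrite lee_fin subr_ge0.
Qed.

(** A continuous substitute for the indicator of the half-line up to 1/2: it
    falls from 1 to 0 on [1/2, 1/2 + e]. *)
Definition ramp {R : realType} (e x : R) : R :=
  Num.max 0 (Num.min 1 ((1 / 2 + e - x) / e)).

Lemma ramp_itv {R : realType} (e x : R) : 0 <= ramp e x <= 1.
Proof. by rewrite /ramp le_max lexx/= ge_max ler01/= ge_min lexx. Qed.

Lemma ramp_ge1 {R : realType} (e x : R) : 0 < e -> x <= 1 / 2 -> 1 <= ramp e x.
Proof.
move=> e0 xh; rewrite /ramp le_max le_min lexx/= ler_pdivlMr//.
by apply/orP; right; lra.
Qed.

Lemma ramp_neq0 {R : realType} (e x : R) :
  0 < e -> ramp e x != 0 -> x <= 1 / 2 + e.
Proof.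
move=> e0; apply: contra_neqT; rewrite -ltNge => xe.
rewrite /ramp max_l// ge_min; apply/orP; right.
by rewrite ler_pdivrMr// mul0r; lra.
Qed.

Lemma continuous_ramp {R : realType} (e : R) : continuous (ramp e).
Proof.
move=> x; apply: (@continuous_max R R (cst 0)
  (fun x => Num.min 1 ((1 / 2 + e - x) / e))); first exact: cvg_cst.
apply: (@continuous_min R R (cst 1) (fun x => (1 / 2 + e - x) / e)).
  exact: cvg_cst.
by apply: cvgM; [apply: cvgB; [exact: cvg_cst|exact: cvg_id]|exact: cvg_cst].
Qed.

(** Of the continuous test functions [left] and [right], mirror images of each
    other, at least one equals 1 at any given atom, so its integral against
    [Q n] is at least [c]; against the uniform law both have an integral of at
    most [1/2 + e < c]. Having two fixed test functions avoids following the
    atoms along a convergent subsequence. *)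
Lemma large_atoms_not_weak_cvg_uniform {R : realType}
    (Q : nat -> probability R R) (c : R) : 1 / 2 < c ->
  (\forall n \near \oo, exists x, (c%:E <= Q n [set x])%E) ->
  ~ weak_cvg Q (uniform_prob (@ltr01 R)).
Proof.
move=> c2 atoms Qcvg.
(* Half of the room between 1/2 and c, so that 1/2 + e < c stays strict. *)
pose e := (c - 1 / 2) / 2.
have e0 : 0 < e by rewrite /e; lra.
have ec : 1 / 2 + e < c by rewrite /e; lra.
pose left := ramp e; pose right x := ramp e (1 - x).
have cl : continuous left by exact: continuous_ramp.
have cr : continuous right.
  move=> x; apply: (@continuous_comp _ _ _ (fun x : R => 1 - x) (ramp e)).
    by apply: cvgB; [exact: cvg_cst|exact: cvg_id].
  exact: continuous_ramp.
have l01 x : 0 <= left x <= 1 by exact: ramp_itv.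
have r01 x : 0 <= right x <= 1 by exact: ramp_itv.
have bounded (f : R -> R) :
    (forall x, 0 <= f x <= 1) -> exists M, forall x, `|f x| <= M.
  by move=> f01; exists 1 => x; case/andP: (f01 x) => f0 f1; rewrite ger0_norm.
have small (f : R -> R) : continuous f -> (forall x, 0 <= f x <= 1) ->
    (\int[uniform_prob (@ltr01 R)]_x (f x)%:E <= (1 / 2 + e)%:E)%E ->
    \forall n \near \oo, (\int[Q n]_x (f x)%:E < c%:E)%E.
  move=> cf f01 fe; apply: (Qcvg f cf (bounded f f01) [set y | (y < c%:E)%E]).
  apply: open_nbhs_nbhs; split.
    exact: open_ereal_lt_ereal.
  by apply: le_lt_trans fe _; rewrite lte_fin.
have nl : \forall n \near \oo, (\int[Q n]_x (left x)%:E < c%:E)%E.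
  apply: small => //; rewrite -[1 / 2 + e]subr0; apply: integral_uniform01_le => //.
  - exact: continuous_measurable_fun.
  - by move=> x /andP[x0 _] /(ramp_neq0 _ _ e0) ->; rewrite x0.
  - by lra.
have nr : \forall n \near \oo, (\int[Q n]_x (right x)%:E < c%:E)%E.
  apply: small => //; rewrite (_ : 1 / 2 + e = 1 - (1 / 2 - e)); last by lra.
  apply: integral_uniform01_le => //.
  - exact: continuous_measurable_fun.
  - by move=> x /andP[_ x1] /(ramp_neq0 _ _ e0) xe; rewrite x1 andbT; lra.
  - by lra.
have [n [[[x Qx] ln] rn]] := filter_ex (filterI (filterI atoms nl) nr).
have contra (f : R -> R) : continuous f -> (forall x, 0 <= f x <= 1) -> 1 <= f x ->
    (\int[Q n]_x (f x)%:E < c%:E)%E -> False.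
  move=> cf f01 fx; apply/negP; rewrite -leNgt (le_trans Qx)//.
  apply: le_integral_of_ge1 => //.
  - exact: continuous_measurable_fun.
  - by move=> y; case/andP: (f01 y).
  - by move=> y ->.
have [xh|hx] := leP x (1 / 2).
- by apply: (contra left) => //; exact: ramp_ge1.
- by apply: (contra right) => //; apply: ramp_ge1 => //; lra.
Qed.

(** * Binomial upper tails *)

Lemma bin_succ_le (n k : nat) :
  (3 * n <= 4 * k)%N -> (3 * 'C(n, k.+1) <= 'C(n, k))%N.
Proof.
move=> nk; rewrite -(@leq_pmul2l k.+1)// mulnCA mul_bin_left mulnA.
by rewrite leq_mul2r; apply/orP; right; lia.
Qed.

(** The terms of the tail decrease at least by a factor 3 from one to the next,
    so the tail is bounded by a geometric series of sum [3/2] times its first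
    term. The induction descends from [k = #|I|.+1], where the tail is empty. *)
Lemma card_upper_tail_le (I : finType) (k : nat) : (3 * #|I| <= 4 * k)%N ->
  (2 * #|[set A : {set I} | (k <= #|A|)%N]%SET| <= 3 * 'C(#|I|, k))%N.
Proof.
elim: {k}(#|I|.+1 - k)%N {-2}k (leqnn (#|I|.+1 - k)) => [|m IH] k km Ik.
  rewrite (_ : [set _ | _]%SET = finset.set0) ?cards0//.
  apply/finset.setP => A; rewrite !inE; apply/negbTE; rewrite -ltnNge.
  by rewrite (leq_ltn_trans (max_card (mem A)))//; lia.
rewrite (_ : [set A : {set I} | (k <= #|A|)%N]%SET =
    ([set A : {set I} | #|A| == k] :|: [set A : {set I} | (k < #|A|)%N])%SET); last first.
  by apply/finset.setP => A; rewrite !inE leq_eqVlt eq_sym.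
have := leq_card_setU [set A : {set I} | #|A| == k]%SET
  [set A : {set I} | (k < #|A|)%N]%SET.
rewrite card_draws => -[+ _].
have := IH k.+1; have := bin_succ_le _ _ Ik; lia.
Qed.

(** * Fair two-valued variables *)

(** The set of successful indices, rather than their number, is what
    independence describes directly: all subsets are equally likely. *)
Definition hits {I : finType} {T : Type} {R : eqType} (X : I -> T -> R) (b : R)
    (t : T) : {set I} :=
  [set i | X i t == b]%SET.

Section fair_coins.
Context {d} {T : measurableType d} {R : realType} (P : probability T R).
Context {I : finType} (X : I -> {RV P >-> R}) (a b : R).
Context (ab : a != b) (X_indep : mutually_independent X).
Context (X_values : forall i t, X i t = a \/ X i t = b).
Context (X_a : forall i, P [set t | X i t = a] = (1 / 2)%:E).
Context (X_b : forall i, P [set t | X i t = b] = (1 / 2)%:E).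

(* [hits X b t = A] is the event that every [X i] lies in [cell A i]. *)
Let cell (A : {set I}) (i : I) : set R := if i \in A then [set b] else [set a].

Let hits_cells (A : {set I}) : [set t | hits X b t = A] =
  \bigcap_(i in [set` [set: I]%SET]) (X i @^-1` cell A i).
Proof.
apply/seteqP; split => [t /= <- i _|t tA].
  rewrite /cell /= inE; have [//|/eqP Xib] := eqVneq (X i t) b.
  by have [|/Xib] := X_values i t.
apply/finset.setP => i; have := tA i; rewrite /= !inE => /(_ isT).
rewrite /cell; case: ifP => _ /= ->; first exact: eqxx.
exact: negbTE.
Qed.

Let measurable_cell (A : {set I}) (i : I) : measurable (cell A i).
Proof. by rewrite /cell; case: ifP. Qed.

Let measurable_hits_eq (A : {set I}) : measurable [set t | hits X b t = A].
Proof.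
rewrite hits_cells; apply: fin_bigcap_measurable => // i _.
by rewrite -[X in measurable X]setTI; exact: measurable_funP.
Qed.

Let probability_hits_eq (A : {set I}) :
  P [set t | hits X b t = A] = (2%:R ^- #|I|)%:E.
Proof.
rewrite hits_cells X_indep//.
rewrite (eq_bigr (fun=> (2^-1)%:E)); last first.
  move=> i _; rewrite /cell; case: ifP => _.
  - by rewrite -div1r -(X_b i).
  - by rewrite -div1r -(X_a i).
by rewrite prodEFin prodr_const cardsT exprVn.
Qed.

Let hits_bigcup (U : {set {set I}}) : [set t | hits X b t \in U] =
  \bigcup_(A in [set` U]) [set t | hits X b t = A].
Proof.
by apply/seteqP; split => [t tU|t [A AU /= ->]]; first by exists (hits X b t).
Qed.

Lemma measurable_hits (U : {set {set I}}) :
  measurable [set t | hits X b t \in U].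
Proof. by rewrite hits_bigcup; exact: fin_bigcup_measurable. Qed.

(** Probabilities of events that depend on the set of successes alone reduce to
    counting subsets. *)
Lemma probability_hits (U : {set {set I}}) :
  P [set t | hits X b t \in U] = (#|U|%:R / 2 ^+ #|I|)%:E.
Proof.
rewrite hits_bigcup measure_fin_bigcup//; last first.
  by move=> A B _ _ [t [/= -> ->]].
rewrite (_ : [set` U] = [set` enum U]); last first.
  by apply/seteqP; split => A; rewrite /= mem_enum.
rewrite -fsbig_seq ?enum_uniq// big_enum/=.
under eq_bigr do rewrite probability_hits_eq.
by rewrite sumEFin sumr_const mulr_natl.
Qed.

End fair_coins.

Lemma expectation_two_valued {d} {T : measurableType d} {R : realType}
    (P : probability T R) (X : {RV P >-> R}) (a b p : R) :
  (forall t, X t = a \/ X t = b) -> P [set t | X t = b] = p%:E ->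
  'E_P[X]%E = (a + (b - a) * p)%:E.
Proof.
move=> Xab Xp; have mB : measurable [set t | X t = b].
  by rewrite -[X in measurable X]setTI; exact: (measurable_funP X _ [set b]).
have L1 : (\1_[set t | X t = b] : T -> R) \in Lfun P 1.
  by apply/Lfun1_integrable; exact: integrable_indic.
have L2 : ((b - a) \o* \1_[set t | X t = b] : T -> R) \in Lfun P 1.
  exact: Lfun_scale.
rewrite (_ : (X : T -> R) = cst a \+ ((b - a) \o* \1_[set t | X t = b])).
  rewrite expectationD//; last exact: Lfun_cst.
  by rewrite expectation_cst expectationZl// expectation_indic// Xp -EFinM -EFinD.
apply/funext => t; rewrite /= indicE.
have [/set_mem/= ->|/negP nb] := boolP (t \in _); first by rewrite mul1r addrC subrK.
by have [->|Xb] := Xab t; [rewrite mul0r addr0|exfalso; apply: nb; exact/mem_set].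
Qed.

(** * The surviving sample mean *)

Section file_drawer.
Context {d} {T : measurableType d} {R : realType} (P : probability T R).
Context {n : nat} (X : 'I_n -> {RV P >-> R}).
Context (X_indep : mutually_independent X).
Context (X_values : forall i t, X i t = - (3 / 2) \/ X i t = 1 / 2).
Context (X_low : forall i, P [set t | X i t = - (3 / 2)] = (1 / 2)%:E).
Context (X_high : forall i, P [set t | X i t = 1 / 2] = (1 / 2)%:E).

(* The sample mean when exactly [j] of the draws equal 1/2. *)
Let mean (j : nat) : R := n%:R^-1 * (2 * j%:R - 3 / 2 * n%:R).

Let sample_mean_hits t : sample_mean X t = mean #|hits X (1 / 2) t|.
Proof.
rewrite /sample_mean /mean; congr *%R.
rewrite (eq_bigr (fun i => 2 * (i \in hits X (1 / 2) t)%:R - 3 / 2)); last first.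
  move=> i _; rewrite inE; have [->|] := eqVneq (X i t); first by rewrite mulr1; lra.
  by have [->|->] := X_values i t; [rewrite mulr0 add0r|rewrite eqxx].
rewrite big_split/= -mulr_sumr -natr_sum -big_mkcond/= sum1_card.
by rewrite sumr_const card_ord mulNrn -(mulr_natr (3 / 2)).
Qed.

(* With [n > 16] the largest possible mean, 1/2, survives, so that survival has
   positive probability; a surviving mean is positive, whence [3n <= 4k]. *)
Let threshold : (16 < n)%N -> exists k : nat,
  [/\ (3 * n <= 4 * k)%N, (k <= n)%N &
      forall j, (2 < Num.sqrt n%:R * mean j) = (k <= j)%N].
Proof.
move=> n16; have n0 : (0 : R) < n%:R by rewrite ltr0n; lia.
have s0 : (0 : R) < Num.sqrt n%:R by rewrite sqrtr_gt0.
have meann : mean n = 1 / 2.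
  by rewrite /mean -mulrBl mulrCA mulVf ?gt_eqF//; lra.
have s4 : (4 : R) < Num.sqrt n%:R.
  by rewrite -[4]ger0_norm// -sqrtr_sqr ltr_sqrt// -natrX ltr_nat.
have surv_n : 2 < Num.sqrt n%:R * mean n by rewrite meann; lra.
have mean_mono i j : (i <= j)%N ->
    Num.sqrt n%:R * mean i <= Num.sqrt n%:R * mean j.
  move=> ij; rewrite ler_pM2l// /mean ler_pM2l ?invr_gt0//.
  by rewrite lerD2r ler_pM2l// ler_nat.
have [k surv_k k_min] := ex_minnP (ex_intro (fun j => 2 < Num.sqrt n%:R * mean j) n surv_n).
exists k; split; [|exact: k_min|move=> j; apply/idP/idP; first exact: k_min].
- have : 0 < mean k by rewrite -(pmulr_rgt0 _ s0) (lt_trans _ surv_k).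
  rewrite /mean pmulr_rgt0 ?invr_gt0// => k0.
  rewrite -(ler_nat R) !natrM; lra.
- by move=> /mean_mono; exact: lt_le_trans.
Qed.

(** The atom sits at the p-value of the smallest surviving mean. Its conditional
    mass is the first term of the binomial tail divided by the tail. *)
Lemma pvalue_has_large_atom (mu : R) : (16 < n)%N -> exists x,
  ((2 / 3)%:E <= cond_distribution P (measurable_survival X)
    (pvalue n mu \o sample_mean X) [set x])%E.
Proof.
move=> /threshold[k [nk kn survP]]; exists (pvalue n mu (mean k)).
pose tail := [set A : {set 'I_n} | (k <= #|A|)%N]%SET.
pose level := [set A : {set 'I_n} | #|A| == k]%SET.
have ab : - (3 / 2) != 1 / 2 :> R by rewrite lt_eqF//; lra.
have survE : survival X = [set t | hits X (1 / 2) t \in tail].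
  apply/seteqP; split => t;
    by rewrite /survival /= sample_mean_hits survP inE.
pose B := [set t | hits X (1 / 2) t \in level].
have mB : measurable B by exact: (measurable_hits P X _ _ ab).
have BS : B `&` survival X = B.
  apply/setIidl; rewrite survE => t; rewrite /B /= !inE => /eqP ->.
  exact: leqnn.
have PE (U : {set {set 'I_n}}) :
    P [set t | hits X (1 / 2) t \in U] = (#|U|%:R / 2 ^+ n)%:E.
  by rewrite (probability_hits P X _ _ ab)// card_ord.
have level_gt0 : (0 < #|level|)%N by rewrite card_draws card_ord bin_gt0.
have tail_le : (2 * #|tail| <= 3 * #|level|)%N.
  have := card_upper_tail_le 'I_n k; rewrite card_draws card_ord; exact.
have tail_gt0 : (0 < #|tail|)%N.
  apply: (leq_trans level_gt0); apply/subset_leq_card/fintype.subsetP => A.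
  by rewrite !inE => /eqP ->.
have pow_gt0 : (0 : R) < 2 ^+ n by rewrite exprn_gt0.
have PS : P (survival X) = (#|tail|%:R / 2 ^+ n)%:E by rewrite survE PE.
apply: (@le_trans _ _ (cond_prob P (measurable_survival X) B)).
  rewrite cond_probE PS ?BS; last first.
    by rewrite eqe gt_eqF// divr_gt0// ltr0n.
  rewrite /B PE /= -EFinM lee_fin invf_div mulrA divfK ?gt_eqF//.
  rewrite ler_pdivlMr ?ltr0n// -[2 / 3]mulrC -mulrA mulrC ler_pdivrMr//.
  by rewrite -!natrM ler_nat [X in (_ <= X)%N]mulnC.
rewrite /cond_distribution /distribution /pushforward.
apply: le_measure; rewrite ?inE//.
move=> t; rewrite /B /= inE => /eqP tk.
by rewrite sample_mean_hits tk.
Qed.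

End file_drawer.

Theorem lemma1 (R : realType) (d : nat -> measure_display)
  (T : forall n : nat, measurableType (d n))
  (P : forall n : nat, probability (T n) R)
  (X : forall n : nat, 'I_n -> {RV (P n) >-> R})
  (mu : nat -> R)
  (X_iid : forall n : nat, iid (X n))
  (X_values : forall (n : nat) (i : 'I_n) (t : T n),
    X n i t = - (3 / 2) \/ X n i t = 1 / 2)
  (X_low : forall (n : nat) (i : 'I_n),
    P n [set t | X n i t = - (3 / 2)] = (1 / 2)%:E)
  (X_high : forall (n : nat) (i : 'I_n),
    P n [set t | X n i t = 1 / 2] = (1 / 2)%:E)
  (mu_mean : forall (n : nat) (i : 'I_n), 'E_(P n)[X n i]%E = (mu n)%:E) :
  (forall n : nat, (0 < n)%N -> mu n = - (1 / 2)) /\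
  ~ weak_cvg
      (fun n : nat =>
        cond_distribution (P n) (measurable_survival (X n))
          (pvalue n (mu n) \o sample_mean (X n)))
      (uniform_prob (@ltr01 R)).
Proof.
split=> [n n0|].
  have := mu_mean n (Ordinal n0).
  rewrite (expectation_two_valued _ _ _ _ _ (X_values n _) (X_high n _)) => -[<-].
  by lra.
apply: (@large_atoms_not_weak_cvg_uniform _ _ (2 / 3)); first by lra.
exists 17%N => // n /= n16; apply: pvalue_has_large_atom => //.
by have [] := X_iid n.
Qed.
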